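(* Let $\mathcal{H}=A_1^2(\mathbb{D})$. For each $k\in\mathbb{N}=\{1,2,3,\ldots\}$ let $$s_k(z)=\sum_{n=0}^\infty\Big\{\frac{n+1}{k}\Big\}z^n,\qquad z\in\mathbb{D},$$ where $\{y\}$ denotes the fractional part of the real number $y$ (so $s_1=0$), and let $T_k$ be the bounded operator on $\mathcal{H}$ defined by $$(T_kf)(z)=k^{1/2}z^{k-1}f(z^k)\frac{1-z^k}{1-z},\qquad z\in\mathbb{D},\ f\in\mathcal{H}.$$ Let $\mathcal{H}_0$ be the closed linear span of $\{s_k:k=2,3,\ldots\}$ in $\mathcal{H}$. Then for any $k,m\in\mathbb{N}$ with $m\ge 2$, $$T_ks_m=k^{1/2}\Big(s_{km}-\frac1m s_k\Big).$$ In particular, $T_k(\mathcal{H}_0)\subseteq\mathcal{H}_0$ for every $k\in\mathbb{N}$.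
   Context: $\mathbb{D}=\{z\in\mathbb{C}:|z|<1\}$ is the open unit disk. $dA=\pi^{-1}\,dx\,dy$ is the normalized area measure on $\mathbb{D}$, and $dA_1(z)=2(1-|z|^2)\,dA(z)$, a probability measure on $\mathbb{D}$. The weighted Bergman space $\mathcal{H}=A_1^2(\mathbb{D})$ is the Hilbert space of all analytic functions on $\mathbb{D}$ lying in $L^2(\mathbb{D},dA_1)$, with the inner product of $L^2(\mathbb{D},dA_1)$; for $f(z)=\sum_{n\ge 0}a_nz^n$ one has $\|f\|_2^2=\sum_{n\ge 0}\frac{2|a_n|^2}{(n+1)(n+2)}$. *)

(* Defs.v *)
From HB Require Import structures.
From mathcomp Require Import all_boot all_order all_algebra.
From mathcomp Require Import complex.
From mathcomp Require Import all_classical all_reals all_analysis.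

Set Implicit Arguments.
Unset Strict Implicit.
Unset Printing Implicit Defensive.

Import Order.TTheory GRing.Theory Num.Theory.
Import numFieldNormedType.Exports.

Local Open Scope classical_set_scope.
Local Open Scope ring_scope.
Local Open Scope complex_scope.

Definition frac_part (R : realType) (y : R) : R := y - (Num.floor y)%:~R.

Definition disk (R : realType) : set R[i] := [set z | Normc.normc z < 1].

(* The type R[i]^o carries the topology of the modulus and is normed over R[i]
   itself, so that derivable below is complex differentiability. *)
Definition analytic_on_disk (R : realType) (f : R[i] -> R[i]) : Prop :=
  forall z : R[i], disk z ->
    derivable (f : R[i]^o -> R[i]^o) (z : R[i]^o) (1 : R[i]^o).

(* Integral against dA_1 = 2 (1 - |z|^2) pi^-1 dx dy over the unit disk, where
   the plane is R * R with the product Lebesgue measure. *)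
Definition integral_dA1 (R : realType) (F : R[i] -> R) : \bar R :=
  (\int[@lebesgue_measure R \x @lebesgue_measure R]_(p in
      [set p : R * R | disk (p.1 +i* p.2)])
    (F (p.1 +i* p.2) * (2 * (1 - Normc.normc (p.1 +i* p.2) ^+ 2) / pi))%:E)%E.

Definition bergman_norm (R : realType) (f : R[i] -> R[i]) : \bar R :=
  sqrte (integral_dA1 (fun z => Normc.normc (f z) ^+ 2)).

(* Elements of the Bergman space are represented by total functions; only
   their values on the disk matter. *)
Definition bergman (R : realType) : set (R[i] -> R[i]) :=
  [set f | analytic_on_disk f /\ (bergman_norm f < +oo)%E].

Definition lin_span (R : realType) (S : set (R[i] -> R[i])) :
    set (R[i] -> R[i]) :=
  [set g | exists (n : nat) (c : 'I_n -> R[i]) (h : 'I_n -> R[i] -> R[i]),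
     (forall i, S (h i)) /\ g = (fun z => \sum_(i < n) c i * h i z)].

Definition closed_span (R : realType) (S : set (R[i] -> R[i])) :
    set (R[i] -> R[i]) :=
  [set f | bergman f /\
     forall e : R, 0 < e ->
       exists2 g, lin_span S g & (bergman_norm (fun z => (f z - g z)%R) < e%:E)%E].

Definition s_fun (R : realType) (k : nat) (z : R[i]) : R[i] :=
  limn (series (fun n : nat =>
    (frac_part (n.+1%:R / k%:R : R))%:C * z ^+ n : R[i]^o)).

Definition T_op (R : realType) (k : nat) (f : R[i] -> R[i]) : R[i] -> R[i] :=
  fun z => (Num.sqrt (k%:R : R))%:C * z ^+ k.-1 * f (z ^+ k)
           * ((1 - z ^+ k) / (1 - z)).

Definition H0 (R : realType) : set (R[i] -> R[i]) :=
  closed_span [set s_fun (R := R) k | k in [set k : nat | (2 <= k)%N]].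

(* Main.v *)
Require Import Defs.
From HB Require Import structures.
From mathcomp Require Import all_boot all_order all_algebra.
From mathcomp Require Import complex.
From mathcomp Require Import all_classical all_reals all_analysis.
From mathcomp Require Import measurable_realfun.
From mathcomp Require Import ring lra.
Import Order.TTheory GRing.Theory Num.Theory.
Import numFieldNormedType.Exports.
Local Open Scope classical_set_scope.
Local Open Scope ring_scope.
Local Open Scope complex_scope.

Set Implicit Arguments.
Unset Strict Implicit.
Unset Printing Implicit Defensive.

(* Summing the k-periodic coefficients gives, on the disk,
   s_k(z) = 1 / (k (1 - z)^2) - z^(k-1) / ((1 - z) (1 - z^k)),
   from which the formula for T_k s_m is a rational identity.

   Invariance of H_0 then follows from the boundedness of T_k, which amounts to
   int G(z^k) dm(z) <= K int G dm for the measure dm = |z|^-2 dx dy.  This m is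
   the Haar measure of the multiplicative group of nonzero complex numbers.
   Since every nonzero number has a k-th root, G |-> int G(z^k) dm(z) is again
   multiplicatively invariant, and the uniqueness argument for Haar measures
   (Tonelli with an auxiliary function h) gives
   int G(z^k) dm * int h dm = int h(z^-k) dm * int G dm,
   so that neither polar coordinates nor a planar change of variables beyond
   the linear maps z |-> w z is needed. *)

(** * Elementary facts on the real-valued modulus *)

Section normc.
Variable R : realType.
Implicit Types z : R[i].

Lemma normc_normE z : `|z| = (Normc.normc z)%:C.
Proof. by []. Qed.

Lemma normc_ge0 z : 0 <= Normc.normc z.
Proof. by case: z => a b; exact: sqrtr_ge0. Qed.

Lemma normcX z n : Normc.normc (z ^+ n) = Normc.normc z ^+ n.
Proof. by apply: complexI; rewrite rmorphXn/= -!normc_normE normrX. Qed.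

Lemma normcX2E z : Normc.normc z ^+ 2 = complex.Re z ^+ 2 + complex.Im z ^+ 2.
Proof. by case: z => a b /=; rewrite sqr_sqrtr// addr_ge0// sqr_ge0. Qed.

Lemma normcB_le (x y x' y' : R) :
  Normc.normc ((x +i* y) - (x' +i* y')) <= `|x - x'| + `|y - y'|.
Proof.
rewrite -[leRHS]ger0_norm ?addr_ge0// -sqrtr_sqr /=.
apply: ler_wsqrtr; rewrite -(real_normK (num_real (x - x'))) -(real_normK (num_real (y - y'))).
have := normr_ge0 (x - x'); have := normr_ge0 (y - y'); nra.
Qed.

End normc.

(** * Summation of the series [s_k] on the disk *)

Section closed_form.
Variable R : realType.
Local Notation C := R[i].

Lemma frac_part_nat (n k : nat) : (0 < k)%N ->
  frac_part (n%:R / k%:R : R) = (n %% k)%:R / k%:R.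
Proof.
move=> k0; have kR : (0 : R) < k%:R by rewrite ltr0n.
rewrite /frac_part (@floor_def _ _ (n %/ k)%:Z).
  rewrite {1}(divn_eq n k) natrD natrM mulrDl mulfK ?gt_eqF//.
  by rewrite addrAC subrr add0r.
have zE (j : nat) : j%:Z%:~R = j%:R :> R by [].
rewrite intrD !zE natr1 ler_pdivlMr// ltr_pdivrMr//.
by rewrite -!natrM ler_nat ltr_nat leq_trunc_div ltn_ceil.
Qed.

Definition s_coef (k n : nat) : C := ((n.+1 %% k)%:R / k%:R).

Lemma s_coefD k n : s_coef k (n + k) = s_coef k n.
Proof. by rewrite /s_coef -addSn modnDr. Qed.

(* The remainder of the series after N terms is [z ^+ N * s_tail k z N]. *)
Definition s_tail (k : nat) (z : C) (N : nat) : C :=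
  (\sum_(r < k) s_coef k (N + r) * z ^+ r) / (1 - z ^+ k).

(** By periodicity the coefficient entering the window at [N + k] equals the one leaving it at [N],
    so the numerators of [s_tail k z N] and [z * s_tail k z N.+1] differ by
    [s_coef k N * (1 - z ^+ k)]. *)
Lemma s_tailS k z N : (0 < k)%N -> 1 - z ^+ k != 0 ->
  s_tail k z N = s_coef k N + z * s_tail k z N.+1.
Proof.
case: k => // k _ zk; rewrite /s_tail mulrA -[s_coef _ N](mulfK zk) -mulrDl.
congr (_ / _); rewrite big_ord_recl [X in z * X]big_ord_recr/= addn0 expr0 mulr1.
rewrite [X in z * (_ + X * _)](_ : _ = s_coef k.+1 N); last first.
  by rewrite -(s_coefD _ N) addSnnS.
rewrite (eq_bigr (fun i : 'I_k => z * (s_coef k.+1 (N.+1 + i) * z ^+ i))) -?mulr_sumr.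
  by rewrite exprS; ring.
by move=> i _; rewrite exprS addSnnS mulrCA.
Qed.

(** The derivative of a finite geometric sum, cleared of denominators. *)
Lemma sum_succ_geometric (k : nat) (z : C) :
  (\sum_(r < k) r.+1%:R * z ^+ r) * (1 - z) ^+ 2 =
  1 - k.+1%:R * z ^+ k + k%:R * z ^+ k.+1.
Proof.
elim: k => [|k IH]; first by rewrite big_ord0; ring.
by rewrite big_ord_recr/= mulrDl IH !exprS -!natr1; ring.
Qed.

Definition s_closed (k : nat) (z : C) : C :=
  k%:R^-1 / (1 - z) ^+ 2 - z ^+ k.-1 / ((1 - z) * (1 - z ^+ k)).

Lemma s_tail0 k z : (0 < k)%N -> 1 - z != 0 -> 1 - z ^+ k != 0 ->
  s_tail k z 0 = s_closed k z.
Proof.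
case: k => // k _ z1 zk; have k0 : k.+1%:R != 0 :> C by rewrite pnatr_eq0.
have z2 : (1 - z) ^+ 2 != 0 by rewrite expf_neq0.
(* The last coefficient has residue 0; the others are [r.+1 / k.+1] for [r < k], which gives a
   differentiated geometric sum. *)
rewrite /s_tail big_ord_recr/= add0n {2}/s_coef modnn !mul0r addr0.
rewrite (eq_bigr (fun r : 'I_k => k.+1%:R^-1 * ((r : nat).+1%:R * z ^+ r))); last first.
  by move=> i _; rewrite /s_coef add0n modn_small ?ltnS// mulrAC mulrC mulrA.
rewrite -mulr_sumr.
have -> : \sum_(i < k) (i : nat).+1%:R * z ^+ i =
    (1 - k.+1%:R * z ^+ k + k%:R * z ^+ k.+1) / (1 - z) ^+ 2.
  by rewrite -sum_succ_geometric mulfK.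
move: k0 zk; rewrite /s_closed/= exprS -!natr1 => k0 zk.
by field; rewrite k0 z1 zk.
Qed.

Lemma disk_lt1 (z : C) : disk z = (`|z| < 1) :> Prop.
Proof. by rewrite normc_normE -[1]/(1%:C) ltcR. Qed.

Lemma one_sub_neq0 (z : C) : disk z -> 1 - z != 0.
Proof.
rewrite disk_lt1 subr_eq0; apply: contraTneq => <-; by rewrite normr1 ltxx.
Qed.

Lemma diskX k (z : C) : (0 < k)%N -> disk z -> disk (z ^+ k).
Proof. by rewrite !disk_lt1 normrX => k0 z1; rewrite exprn_ilt1// -lt0n. Qed.

(** The partial sum of [N] terms misses the closed form by [z ^+ N * s_tail k z N], where the tail
    is bounded uniformly in [N] and [z ^+ N] tends to 0. *)
Lemma s_fun_closed k (z : C) : (0 < k)%N -> disk z -> s_fun k z = s_closed k z.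
Proof.
move=> k0 zD; have z1 := one_sub_neq0 zD; have zk := one_sub_neq0 (diskX k0 zD).
rewrite /s_fun; apply: (@cvg_lim C^o) => //.
have tailE N : series (fun n : nat => (frac_part (n.+1%:R / k%:R : R))%:C * z ^+ n : C^o) N
   = s_closed k z - z ^+ N * s_tail k z N.
  elim: N => [|N IH]; first by rewrite /series/= big_geq// expr0 mul1r s_tail0// subrr.
  rewrite /series/= big_nat_recr//= -[X in X + _]/(series _ N) IH s_tailS//.
  rewrite frac_part_nat// rmorphM fmorphV !rmorph_nat -/(s_coef k N) exprS; ring.
rewrite (_ : series _ = fun N => s_closed k z - z ^+ N * s_tail k z N); last first.
  by apply/funext.
rewrite -[X in _ --> X]subr0; apply: cvgB; first exact: cvg_cst.
apply/cvgr0Pnorm_lt => e e0.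
(* A positive element of [R[i]] is real, so the estimate can be carried out in [R]. *)
have eE : e = (complex.Re e)%:C by rewrite RRe_real// gtr0_real.
have Re0 : 0 < complex.Re e by rewrite -ltcR -eE.
(* The numerator of the tail has [k] terms, each a coefficient at most 1 times a power of [z] of
   modulus at most 1. *)
pose M := k%:R / Normc.normc (1 - z ^+ k).
have Mge : forall N, `|s_tail k z N| <= M%:C.
  move=> N; rewrite /s_tail normrM normfV.
  have -> : M%:C = k%:R / `|1 - z ^+ k| by rewrite /M rmorphM fmorphV rmorph_nat.
  rewrite ler_wpM2r ?invr_ge0// (le_trans (ler_norm_sum _ _ _))//.
  rewrite -[X in _ <= X%:R]card_ord -sumr_const; apply: ler_sum => i _.
  rewrite normrM normrX; apply: mulr_ile1; rewrite ?exprn_ge0//.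
    rewrite /s_coef normrM normfV !normr_nat ler_pdivrMr ?ltr0n// mul1r ler_nat.
    by rewrite ltnW// ltn_mod.
  by rewrite exprn_ile1// ltW// -disk_lt1.
have M0 : 0 <= M by rewrite -lecR (le_trans _ (Mge 0))// normr_ge0.
have zz : `|Normc.normc z| < 1.
  by rewrite ger0_norm ?normc_ge0.
(* With [M + 1] the divisor is positive as soon as [0 <= M]. *)
have := cvg_expr zz => /cvgr0Pnorm_lt/(_ (complex.Re e / (M + 1))) /(_ _)[].
  by rewrite divr_gt0// ltr_wpDl.
move=> N _ HN; exists N => // n Nn.
rewrite normrM normrX eE.
have := HN n Nn => /=; rewrite normrX ltr_pdivlMr ?ltr_wpDl// => Hn.
rewrite (@le_lt_trans _ _ ((`|Normc.normc z| ^+ n)%:C * M%:C))//.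
  rewrite [X in _ <= X * _](_ : _ = `|z| ^+ n); last first.
    by rewrite normc_normE -rmorphXn ger0_norm ?normc_ge0.
  by rewrite ler_wpM2l// exprn_ge0.
rewrite -rmorphM ltcR (le_lt_trans _ Hn)// ler_wpM2l ?exprn_ge0//.
by rewrite lerDl.
Qed.
End closed_form.

(** * Lebesgue measure on the plane *)

Section plane.
Variable R : realType.
Local Open Scope ereal_scope.
Local Notation mu := (@lebesgue_measure R).
Definition plane_measure : set (measurableTypeR R * measurableTypeR R) -> \bar R :=
  mu \x mu.
HB.instance Definition _ := Measure.on plane_measure.
Lemma plane_measure_sigma_finite : sigma_finite setT plane_measure.
Proof.
pose I (n : nat) : set R := `[(- n%:R)%R, n%:R%R]%classic.
exists (fun n => I n `*` I n).
  apply/seteqP; split => // -[x y] _ /=.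
  exists (Num.truncn (Num.max `|x| `|y| : R)%R).+1 => //; rewrite /I/= !in_itv/= -!ler_norml.
  have := truncnS_gt (Num.max `|x| `|y| : R)%R; rewrite gt_max => /andP[/ltW ? /ltW ?]//.
move=> n; split; first by apply: measurableX; exact: measurable_itv.
rewrite /plane_measure product_measure1E; [|exact: measurable_itv..].
by rewrite /I/= !lebesgue_measure_itv/=; case: ifP => _; rewrite ?mul0e ?ltry.
Qed.
(* The library's sigma-finite instance on [\x] is masked by its subprobability
   instance and is not inferred for the Lebesgue measure. *)
HB.instance Definition _ := Measure_isSigmaFinite.Build _ _ _ plane_measure
  plane_measure_sigma_finite.
End plane.

(** * Affine substitutions on the line *)

Section affine.
Variable R : realType.
Local Notation mu := (@lebesgue_measure R).

Lemma measurable_affine (a b : R) : measurable_fun setT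
  (fun x : measurableTypeR R => a * x + b : measurableTypeR R).
Proof. by apply: measurable_funD => //; apply: measurable_funM. Qed.

(** The right-hand side is itself a measure in [A], so by uniqueness of Lebesgue measure it suffices
    to compare both on half-open intervals. *)
Lemma lebesgue_measure_affine (a b : R) (A : set R) : a != 0 -> measurable A ->
  (mu A = `|a|%:E * mu ((fun x => a * x + b)%R @^-1` A))%E.
Proof.
move=> a0 mA.
pose phi (x : measurableTypeR R) : measurableTypeR R := a * x + b.
have mphi : measurable_fun setT phi := @measurable_affine a b.
pose nu0 : {measure set (measurableTypeR R) -> \bar R} :=
  measure_function_pushforward__canonical__measure_function_Measure mu mphi.
pose nu := mscale (NngNum (normr_ge0 a)) nu0.
rewrite -[RHS]/(nu A); apply: lebesgue_measure_unique => //.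
move=> _ [[c d] _ <-]; rewrite -[RHS]/(`|a|%:E * mu (phi @^-1` `]c, d]%classic))%E.
rewrite [LHS]lebesgue_measure_itv/= lte_fin.
have [a_gt0|a_lt0] := ltrP 0 a.
  rewrite [X in mu X](_ : _ = `](c - b) / a, (d - b) / a]%classic); last first.
    apply/seteqP; split => x /=; rewrite !in_itv/= ltr_pdivrMr// ler_pdivlMr//;
      by rewrite ltrBlDr lerBrDr [x * a]mulrC.
  rewrite lebesgue_measure_itv/= lte_fin ltr_pM2r ?invr_gt0// ltrD2r.
  case: ifPn => _; last by rewrite mule0.
  rewrite -!EFinD -EFinM gtr0_norm//; congr (_%:E); field; exact: a0.
have {}a_lt0 : a < 0 by rewrite lt_neqAle a0.
(* A negative slope reverses the interval, so the closed end moves to the left. *)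
rewrite [X in mu X](_ : _ = `[(d - b) / a, (c - b) / a[%classic); last first.
  apply/seteqP; split => x /=; rewrite !in_itv/= ltr_ndivlMr// ler_ndivrMr//;
    by rewrite ltrBlDr lerBrDr [x * a]mulrC andbC.
rewrite lebesgue_measure_itv/= lte_fin ltr_nM2r ?invr_lt0// ltrD2r.
case: ifPn => _; last by rewrite mule0.
rewrite -!EFinD -EFinM ltr0_norm//; congr (_%:E); field; exact: a0.
Qed.

Lemma ge0_integral_affine (a b : R) (f : R -> \bar R) : a != 0 ->
  measurable_fun setT f -> (forall x, 0 <= f x)%E ->
  (\int[mu]_x f (a * x + b)%R = `|a|^-1%:E * \int[mu]_x f x)%E.
Proof.
move=> a0 mf f0.
pose phi (x : measurableTypeR R) : measurableTypeR R := a * x + b.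
have mphi : measurable_fun setT phi := @measurable_affine a b.
pose nu0 : {measure set (measurableTypeR R) -> \bar R} :=
  measure_function_pushforward__canonical__measure_function_Measure mu mphi.
pose nu := mscale (NngNum (normr_ge0 a)) nu0.
have -> : (\int[mu]_x f x = \int[nu]_x f x)%E.
  by apply: eq_measure_integral => A mA _; exact: (lebesgue_measure_affine b a0 mA).
rewrite ge0_integral_mscale//=.
have -> : (\int[pushforward mu phi]_x f x = \int[mu]_x f (phi x))%E.
  by rewrite ge0_integral_pushforward.
by rewrite muleA -EFinM mulVf ?normr_eq0// mul1e.
Qed.
End affine.

(** * Similarities of the plane *)

Section linear.
Variable R : realType.
Local Notation mu := (@lebesgue_measure R).
Local Notation T := (measurableTypeR R).
Local Notation plane := (plane_measure (R := R)).

Lemma measurable_linear2 (a b : R) :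
  measurable_fun setT (fun p : T * T => a * p.1 + b * p.2 : T).
Proof.
by apply: measurable_funD; apply: measurable_funM.
Qed.

Lemma measurable_comp_linear (F : T * T -> \bar R) (a b c d : R) :
  measurable_fun setT F ->
  measurable_fun setT
    (fun p : T * T => F (a * p.1 + b * p.2, c * p.1 + d * p.2)).
Proof.
move=> mF; apply: (measurableT_comp mF) => /=.
by apply: measurable_fun_pair; exact: measurable_linear2.
Qed.

(** The map is multiplication by the complex number with parts [a] and [b]. Tonelli splits it into
    two affine substitutions, one coordinate at a time. *)
Lemma ge0_integral_plane_similarity (a b : R) (F : T * T -> \bar R) :
  a ^+ 2 + b ^+ 2 != 0 -> measurable_fun setT F -> (forall p, 0 <= F p)%E ->
  (\int[plane]_p F (a * p.1 + - b * p.2, b * p.1 + a * p.2)%R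
   = (a ^+ 2 + b ^+ 2)^-1%:E * \int[plane]_p F p)%E.
Proof.
move=> ab0 mF F0; rewrite /plane_measure.
have mFL := @measurable_comp_linear F a (- b) b a mF.
rewrite (fubini_tonelli2 _ mFL)//= /fubini_G/=.
(* If [a = 0] the coordinates are exchanged and each substitution contributes a factor [|b|^-1]. *)
have [a0|a0] := eqVneq a 0.
  have b0 : b != 0 by apply: contraNneq ab0 => ->; rewrite a0 expr0n addr0.
  rewrite (fubini_tonelli1 F mF F0) /fubini_F/= a0.
  transitivity (\int[mu]_y (`|b|^-1%:E * \int[mu]_x F ((- b * y + 0)%R, x)))%E.
    apply: eq_integral => y _.
    rewrite -(ge0_integral_affine 0 b0 (f := fun x => F (- b * y + 0, x)%R))//.
      by apply: eq_integral => x _; rewrite !mul0r !add0r !addr0.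
    apply: (measurableT_comp mF) => /=; exact: measurable_fun_pair.
  have mH := @measurable_fun_fubini_tonelli_F _ _ _ _ R mu F mF F0.
  rewrite ge0_integralZl//=; last 2 first.
  - exact: (measurableT_comp mH (@measurable_affine R (- b) 0)).
  - by move=> y _; apply: integral_ge0.
  rewrite (ge0_integral_affine 0 (a := - b) (f := fun y => \int[mu]_x F (y, x))%E)//.
  - rewrite muleA -EFinM normrN -invfM -normrM ger0_norm -?expr2 ?sqr_ge0//.
    by rewrite expr0n add0r.
  - by rewrite oppr_eq0.
  - by move=> y; apply: integral_ge0.
have ca : (a ^+ 2 + b ^+ 2) / a != 0 by rewrite mulf_neq0// invr_neq0.
(* With [x' = a x - b y] as new first variable, the second coordinate [b x + a y] becomes
   [(b / a) x' + ((a^2 + b^2) / a) y]. *)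
have mG := @measurable_comp_linear F 1 0 (b / a) ((a ^+ 2 + b ^+ 2) / a) mF.
transitivity (\int[mu]_y (`|a|^-1%:E *
  \int[mu]_x F (1 * x + 0 * y, b / a * x + (a ^+ 2 + b ^+ 2) / a * y)%R))%E.
  apply: eq_integral => y _.
  rewrite -(ge0_integral_affine (- b * y) a0
    (f := fun x => F (1 * x + 0 * y, b / a * x + (a ^+ 2 + b ^+ 2) / a * y)%R))//.
    by apply: eq_integral => x _; congr (F (_, _)); [ring|field].
  apply: (measurableT_comp mF) => /=.
  by apply: measurable_fun_pair; apply: measurable_funD => //; apply: measurable_funM.
rewrite ge0_integralZl//=; last 2 first.
- exact: (@measurable_fun_fubini_tonelli_G _ _ _ _ R mu _ mG).
- by move=> y _; apply: integral_ge0.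
rewrite -(fubini_tonelli _ mG)//= (fubini_tonelli1 F mF F0) /fubini_F/=.
transitivity (`|a|^-1%:E * \int[mu]_x
    (`|(a ^+ 2 + b ^+ 2) / a|^-1%:E * \int[mu]_y F (x, y)))%E.
  congr (_ * _)%E; apply: eq_integral => x _.
  rewrite -(ge0_integral_affine (b / a * x) ca (f := fun y => F (x, y)))//.
    by apply: eq_integral => y _; rewrite mul1r mul0r addr0 addrC.
  apply: (measurableT_comp mF); exact: measurable_fun_pair.
rewrite ge0_integralZl//=; last 2 first.
- exact: measurable_fun_fubini_tonelli_F.
- by move=> x _; apply: integral_ge0.
rewrite muleA -EFinM -invfM -normrM mulrC divfK// ger0_norm//.
by rewrite addr_ge0// sqr_ge0.
Qed.
End linear.

(** * Measurability of complex-valued maps *)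

Section complex_measurability.
Variable R : realType.
Local Notation C := R[i].
Local Notation T := (measurableTypeR R).

Definition cmeasurable d (X : measurableType d) (f : X -> C) : Prop :=
  measurable_fun setT (fun x => complex.Re (f x) : T) /\
  measurable_fun setT (fun x => complex.Im (f x) : T).

Definition emeasurable_cfun (F : C -> \bar R) : Prop :=
  measurable_fun setT (fun p : T * T => F (p.1 +i* p.2)).

Lemma cmeasurable_id : cmeasurable (fun p : T * T => p.1 +i* p.2).
Proof. by split; [exact: measurable_fst|exact: measurable_snd]. Qed.

Section generic.
Context d (X : measurableType d).
Implicit Types f g : X -> C.

Lemma cmeasurable_cst (c : C) : cmeasurable (fun _ : X => c).
Proof. by split; exact: measurable_cst. Qed.

Lemma cmeasurableM f g : cmeasurable f -> cmeasurable g ->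
  cmeasurable (fun x => f x * g x).
Proof.
move=> [f1 f2] [g1 g2]; split.
  rewrite (_ : (fun x => _) = (fun x => complex.Re (f x) * complex.Re (g x)
      - complex.Im (f x) * complex.Im (g x))).
    by apply: measurable_funB; exact: measurable_funM.
  by apply/funext => x; case: (f x) (g x) => ? ? [].
rewrite (_ : (fun x => _) = (fun x => complex.Re (f x) * complex.Im (g x)
    + complex.Im (f x) * complex.Re (g x))).
  by apply: measurable_funD; exact: measurable_funM.
by apply/funext => x; case: (f x) (g x) => ? ? [].
Qed.

Lemma cmeasurableX f n : cmeasurable f -> cmeasurable (fun x => f x ^+ n).
Proof.
move=> mf; elim: n => [|n IH].
  by under eq_fun do rewrite expr0; exact: cmeasurable_cst.
by under eq_fun do rewrite exprS; exact: cmeasurableM.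
Qed.

(** On nonnegative reals inversion is the real power of exponent [-1], also at 0, where both take
    the value 0. *)
Lemma measurable_funV_ge0 (g : X -> R) : measurable_fun setT g ->
  (forall x, 0 <= g x) -> measurable_fun setT (fun x => (g x)^-1).
Proof.
move=> mg g0; have -> : (fun x => (g x)^-1) = (fun x => g x `^ (-1)).
  by apply/funext => x; rewrite powR_inv1.
exact: (measurableT_comp (measurable_powR (-1)) mg).
Qed.

Lemma measurable_normcX2 f : cmeasurable f ->
  measurable_fun setT (fun x => Normc.normc (f x) ^+ 2).
Proof.
move=> [f1 f2]; under eq_fun do rewrite normcX2E.
by apply: measurable_funD; apply: measurable_funX.
Qed.

Lemma cmeasurableV f : cmeasurable f -> cmeasurable (fun x => (f x)^-1).
Proof.
move=> mf; have mV : measurable_fun setT (fun x => (Normc.normc (f x) ^+ 2)^-1).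
  apply: measurable_funV_ge0; first exact: measurable_normcX2.
  by move=> x; rewrite sqr_ge0.
case: mf => f1 f2; split.
  rewrite (_ : (fun x => _) = (fun x => complex.Re (f x) * (Normc.normc (f x) ^+ 2)^-1)).
    exact: measurable_funM.
  by apply/funext => x; rewrite normcX2E; case: (f x).
rewrite (_ : (fun x => _) = (fun x => - complex.Im (f x) * (Normc.normc (f x) ^+ 2)^-1)).
  by apply: measurable_funM => //; apply: measurable_funN.
by apply/funext => x; rewrite normcX2E; case: (f x) => a b /=; rewrite mulNr.
Qed.

Lemma emeasurable_cfun_comp (F : C -> \bar R) f : emeasurable_cfun F -> cmeasurable f ->
  measurable_fun setT (fun x => F (f x)).
Proof.
move=> mF [f1 f2]; rewrite (_ : (fun x => _) =
  (fun p : T * T => F (p.1 +i* p.2)) \o (fun x => (complex.Re (f x), complex.Im (f x)))).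
  by apply: (measurableT_comp mF); exact: measurable_fun_pair.
by apply/funext => x /=; case: (f x).
Qed.
End generic.
End complex_measurability.

(** * The Haar integral on the nonzero complex numbers *)

Section haar.
Variable R : realType.
Local Notation C := R[i].
Local Notation T := (measurableTypeR R).
Local Notation plane := (plane_measure (R := R)).
Local Open Scope ereal_scope.

(* With [0^-1 = 0] the density vanishes at the origin, so no almost-everywhere
   argument is needed to discard that point. *)
Definition haar_density (z : C) : \bar R := ((Normc.normc z ^+ 2)^-1)%R%:E.

Definition haar_int (F : C -> \bar R) : \bar R :=
  \int[plane]_p (F (p.1 +i* p.2)%C * haar_density (p.1 +i* p.2)%C).

Lemma haar_density_ge0 z : 0 <= haar_density z.
Proof. by rewrite lee_fin invr_ge0 sqr_ge0. Qed.

Lemma haar_density0 : haar_density 0%R = 0.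
Proof. by rewrite /haar_density ComplexField.Normc.normc0 expr0n invr0. Qed.

Lemma measurable_haar_density d (X : measurableType d) (f : X -> C) :
  cmeasurable f -> measurable_fun setT (fun x => haar_density (f x)).
Proof.
move=> mf; apply/measurable_EFinP; apply: measurable_funV_ge0.
  exact: measurable_normcX2.
by move=> x; exact: sqr_ge0.
Qed.

(** The Jacobian [|w|^2] of multiplication by [w] cancels against the density. *)
Lemma haar_int_mull (w : C) (F : C -> \bar R) : w != 0%R -> emeasurable_cfun F ->
  (forall z, 0 <= F z) -> haar_int (fun z => F (w * z)%R) = haar_int F.
Proof.
move=> w0 mF F0; rewrite /haar_int.
have wn0 : (Normc.normc w ^+ 2 != 0)%R.
  rewrite expf_neq0//; apply: contra_neq w0; exact: ComplexField.Normc.eq0_normc.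
have wE := normcX2E w.
have mH : measurable_fun setT
    (fun p : T * T => F (p.1 +i* p.2)%C * haar_density (p.1 +i* p.2)%C).
  apply: emeasurable_funM; first exact: mF.
  exact: (measurable_haar_density (@cmeasurable_id R)).
have := ge0_integral_plane_similarity (a := complex.Re w) (b := complex.Im w) _ mH.
have HF0 (p : T * T) : 0 <= F (p.1 +i* p.2)%C * haar_density (p.1 +i* p.2)%C.
  by rewrite mule_ge0// haar_density_ge0.
rewrite -wE => /(_ wn0 HF0)/= E; rewrite -[RHS]mul1e -(divff wn0) EFinM -muleA -E.
rewrite -ge0_integralZl_EFin ?sqr_ge0//; last 2 first.
- by move=> p _; rewrite mule_ge0// haar_density_ge0.
- exact: (@measurable_comp_linear R _ (complex.Re w) (- complex.Im w)
    (complex.Im w) (complex.Re w) mH).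
apply: eq_integral => p _; rewrite muleCA.
have -> : ((complex.Re w * p.1 + - complex.Im w * p.2)%R +i*
    (complex.Im w * p.1 + complex.Re w * p.2)%R)%C = (w * (p.1 +i* p.2)%C)%R.
  by case: (w) => a b /=; congr (_ +i* _)%C; rewrite ?mulNr 1?addrC// [(b * _)%R]mulrC.
rewrite /haar_density ComplexField.Normc.normcM exprMn -EFinM; congr (_ * _%:E).
by rewrite [X in _ = (_ * X)%R]invfM mulrA mulfV// mul1r.
Qed.

(** Both sides equal the double Haar integral of [G (u * z ^+ k) * h u]. Integrating over [z] first,
    a [k]-th root of [u] absorbs [u]; integrating over [u] first, [u] is replaced by [u / z ^+ k],
    and then [u] is absorbed in [h]. *)
Lemma haar_int_pow (k : nat) (G h : C -> \bar R) : (0 < k)%N ->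
  emeasurable_cfun G -> (forall z, 0 <= G z) ->
  emeasurable_cfun h -> (forall z, 0 <= h z) ->
  haar_int (fun z => G (z ^+ k)%R) * haar_int h =
  haar_int (fun z => h (z ^- k)%R) * haar_int G.
Proof.
move=> k0 mG G0 mh h0.
pose c (p : T * T) : C := (p.1 +i* p.2)%C.
have mc : cmeasurable c := @cmeasurable_id R.
have m1 : cmeasurable (fun q : (T * T) * (T * T) => c q.1).
  case: mc => m1 m2; split; exact: (measurableT_comp _ measurable_fst).
have m2 : cmeasurable (fun q : (T * T) * (T * T) => c q.2).
  case: mc => m1' m2; split; exact: (measurableT_comp _ measurable_snd).
have root (w : C) : exists v : C, (v ^+ k)%R = w.
  by exists (k.-root w)%R; rewrite rootCK.
have mGk : emeasurable_cfun (fun z => G (z ^+ k)%R).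
  by apply: (emeasurable_cfun_comp mG); exact: cmeasurableX.
have mhk : emeasurable_cfun (fun z => h (z ^- k)%R).
  by apply: (emeasurable_cfun_comp mh); apply: cmeasurableV; exact: cmeasurableX.
(* With [v ^+ k = u], invariance under [z |-> v * z] produces the factor [u]. *)
have GkE (u : C) : u != 0%R ->
  haar_int (fun z => G (z ^+ k)%R) = haar_int (fun z => G (u * z ^+ k)%R).
  move=> u0; have [v vE] := root u.
  have v0 : v != 0%R by apply: contraNneq u0 => v0; rewrite -vE v0 expr0n gtn_eqF.
  rewrite -(haar_int_mull v0 mGk)//; congr haar_int; apply/funext => z.
  by rewrite exprMn vE.
(* Since [h] is taken at [z ^- k], the translation is here by [v^-1]. *)
have hkE (u : C) : u != 0%R ->
  haar_int (fun z => h (z ^- k)%R) = haar_int (fun z => h (u * z ^- k)%R).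
  move=> u0; have [v vE] := root u.
  have v0 : v != 0%R by apply: contraNneq u0 => v0; rewrite -vE v0 expr0n gtn_eqF.
  rewrite -(haar_int_mull (invr_neq0 v0) mhk)//; congr haar_int; apply/funext => z.
  by rewrite exprMn invfM exprVn invrK vE.
have mGu (u : C) : emeasurable_cfun (fun z => G (u * z ^+ k)%R).
  apply: (emeasurable_cfun_comp mG); apply: cmeasurableM; first exact: cmeasurable_cst.
  exact: cmeasurableX.
have mhu (u : C) : emeasurable_cfun (fun z => h (u * z ^- k)%R).
  apply: (emeasurable_cfun_comp mh); apply: cmeasurableM; first exact: cmeasurable_cst.
  by apply: cmeasurableV; exact: cmeasurableX.
have mhz (v : C) : emeasurable_cfun (fun z => h (z * v)%R).
  by apply: (emeasurable_cfun_comp mh); apply: cmeasurableM => //; exact: cmeasurable_cst.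
(* The double integrand before the substitution in [u], with [q.1] as [u] and [q.2] as [z]; [f2] is
   the one after it. *)
pose f1 (q : (T * T) * (T * T)) :=
  G (c q.1 * c q.2 ^+ k)%R * haar_density (c q.2) *
  (h (c q.1) * haar_density (c q.1)).
have f1_ge0 q : 0 <= f1 q by rewrite !mule_ge0// haar_density_ge0.
have mf1 : measurable_fun setT f1.
  apply: emeasurable_funM; apply: emeasurable_funM.
  - by apply: (emeasurable_cfun_comp mG); apply: cmeasurableM => //; exact: cmeasurableX.
  - exact: measurable_haar_density.
  - exact: (emeasurable_cfun_comp mh).
  - exact: measurable_haar_density.
pose f2 (q : (T * T) * (T * T)) :=
  G (c q.1) * haar_density (c q.1) *
  (h (c q.1 * c q.2 ^- k)%R * haar_density (c q.2)).
have f2_ge0 q : 0 <= f2 q by rewrite !mule_ge0// haar_density_ge0.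
have mf2 : measurable_fun setT f2.
  apply: emeasurable_funM; apply: emeasurable_funM.
  - exact: (emeasurable_cfun_comp mG).
  - exact: measurable_haar_density.
  - apply: (emeasurable_cfun_comp mh); apply: cmeasurableM => //.
    by apply: cmeasurableV; exact: cmeasurableX.
  - exact: measurable_haar_density.
have haar_ge0 (F : C -> \bar R) : (forall z, 0 <= F z) -> 0 <= haar_int F.
  by move=> F0; apply: integral_ge0 => p _; rewrite mule_ge0// haar_density_ge0.
have mint (F : C -> \bar R) : emeasurable_cfun F ->
    measurable_fun setT (fun p => F (c p) * haar_density (c p)).
  by move=> mF; apply: emeasurable_funM => //; exact: measurable_haar_density.
have int_ge0 (F : C -> \bar R) p : (forall z, 0 <= F z) -> 0 <= F (c p) * haar_density (c p).
  by move=> F0; rewrite mule_ge0// haar_density_ge0.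
transitivity (\int[plane]_u \int[plane]_z f1 (u, z)).
  rewrite {2}/haar_int -ge0_integralZl//; last 3 first.
  - exact: mint.
  - by move=> p _; exact: int_ge0.
  - by apply: haar_ge0.
  (* At the origin the zero density kills both sides, so the invariance is invoked only for nonzero
     [u]. *)
  apply: eq_integral => u _; have [u0|u0] := eqVneq (c u) 0%R.
    rewrite -/(c u) u0 haar_density0 !mule0 integral0_eq// => z _.
    by rewrite /f1 u0 haar_density0 !mule0.
  rewrite (GkE _ u0) /haar_int -ge0_integralZr//.
  - exact: (mint _ (mGu _)).
  - by move=> z _; exact: (int_ge0 (fun z => G (c u * z ^+ k)%R)).
  - exact: int_ge0.
(* For fixed z, substitute u by u / z^k. *)
rewrite (fubini_tonelli f1)//.
transitivity (\int[plane]_z \int[plane]_u f2 (u, z)).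
  apply: eq_integral => z _; have [z0|z0] := eqVneq (c z) 0%R.
    rewrite !integral0_eq// => u _; by rewrite /f1 /f2 z0 haar_density0 ?mule0 ?mul0e.
  have zk0 : (c z ^+ k != 0)%R by rewrite expf_neq0.
  (* Chosen so that [F (z ^+ k * u)] is [G (u * z ^+ k) * h u]: the substitution is then one
     translation of [F]. *)
  pose F w := G w * h (w * c z ^- k)%R.
  have mF : emeasurable_cfun F by apply: emeasurable_funM => //; exact: mhz.
  have F0 w : 0 <= F w by rewrite mule_ge0.
  transitivity (haar_int (fun w => F (c z ^+ k * w)%R) * haar_density (c z)).
    rewrite /haar_int -ge0_integralZr//; last 3 first.
    - apply: (mint (fun w => F (c z ^+ k * w)%R)); apply: (emeasurable_cfun_comp mF).
      by apply: cmeasurableM => //; exact: cmeasurable_cst.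
    - by move=> u _; exact: (int_ge0 (fun w => F (c z ^+ k * w)%R)).
    - exact: haar_density_ge0.
    apply: eq_integral => u _; rewrite /f1 /F/= -/(c u) [(c z ^+ k * c u)%R]mulrC mulfK//.
    by rewrite -!muleA; congr (_ * _); rewrite muleC -muleA.
  rewrite haar_int_mull// /haar_int -ge0_integralZr//; last 3 first.
  - exact: mint.
  - by move=> u _; exact: int_ge0.
  - exact: haar_density_ge0.
  apply: eq_integral => u _; rewrite /f2 /F/= -/(c u) -!muleA; congr (_ * _).
  by rewrite muleCA.
rewrite -(fubini_tonelli f2)//.
rewrite {2}/haar_int -ge0_integralZl//; last 3 first.
- exact: mint.
- by move=> p _; exact: int_ge0.
- by apply: haar_ge0.
apply: eq_integral => u _; have [u0|u0] := eqVneq (c u) 0%R.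
  rewrite -/(c u) u0 haar_density0 !mule0 integral0_eq// => z _.
  by rewrite /f2 u0 haar_density0 !mule0 mul0e.
rewrite (hkE _ u0) /haar_int -ge0_integralZr//; last 3 first.
- exact: (mint _ (mhu _)).
- by move=> z _; exact: (int_ge0 (fun z => h (c u * z ^- k)%R)).
- exact: int_ge0.
by apply: eq_integral => z _; rewrite /f2/= muleC.
Qed.
End haar.

(** * A bound for the substitution [z |-> z ^+ k], uniform in [k] *)

Section haar_bound.
Variable R : realType.
Local Notation C := R[i].
Local Notation T := (measurableTypeR R).
Local Notation plane := (plane_measure (R := R)).
Local Open Scope ereal_scope.

Lemma plane_measure_itvX (a b c d : R) (b1 b2 b3 b4 : bool) : (a < b)%R -> (c < d)%R ->
  plane ([set` Interval (BSide b1 a) (BSide b2 b)] `*` [set` Interval (BSide b3 c) (BSide b4 d)])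
  = ((b - a) * (d - c))%R%:E.
Proof.
move=> ab cd; rewrite /plane_measure product_measure1E; [|exact: measurable_itv..].
by rewrite /= !lebesgue_measure_itv/= !lte_fin ab cd EFinM.
Qed.

Lemma integral_plane_scaled_indic (r : R) (A : set (T * T)) : (0 <= r)%R -> measurable A ->
  \int[plane]_p (r%:E * (\1_A p)%:E) = r%:E * plane A.
Proof.
move=> r0 mA; rewrite ge0_integralZl_EFin//; last first.
  by apply/measurable_EFinP; exact: measurable_indic.
by rewrite integral_indic// setIT.
Qed.

(** Take for [h] the indicator of the unit square [A]. Its Haar integral is at least 1/5, that of
    [h (z ^- k)] is at most 20, and 100 is the quotient. *)
Lemma haar_int_pow_le (k : nat) (G : C -> \bar R) : (0 < k)%N ->
  emeasurable_cfun G -> (forall z, 0 <= G z) ->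
  haar_int (fun z => G (z ^+ k)%R) <= 100%:R%:E * haar_int G.
Proof.
move=> k0 mG G0.
pose A : set (T * T) := `]1%R, 2%R]%classic `*` `]0%R, 1%R]%classic.
have mA : measurable A by apply: measurableX; exact: measurable_itv.
pose B : set (T * T) := `[(-1)%R, 1%R]%classic `*` `[(-1)%R, 1%R]%classic.
have mB : measurable B by apply: measurableX; exact: measurable_itv.
pose h (z : C) : \bar R := (\1_A (complex.Re z, complex.Im z))%:E.
have h0 z : 0 <= h z by rewrite lee_fin.
have mh : emeasurable_cfun h.
  apply/measurable_EFinP; rewrite (_ : (fun _ => _) = (\1_A : T * T -> R)).
    exact: measurable_indic.
  by apply/funext => -[].
have mc := @cmeasurable_id R.
have md := measurable_haar_density mc.
(* The square avoids the closed unit disk, and its farthest corner from the origin is [(2, 1)]. *)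
have AE (z : C) : A (complex.Re z, complex.Im z) -> (1 < Normc.normc z ^+ 2 <= 5)%R.
  rewrite /A/= !in_itv/= normcX2E => -[/andP[? ?] /andP[? ?]]; apply/andP; split; nra.
have hlow : 5^-1%:E <= haar_int h.
  have -> : 5^-1%:E = \int[plane]_p (5^-1%:E * (\1_A p)%:E).
    rewrite integral_plane_scaled_indic// plane_measure_itvX; [|lra|lra].
    by rewrite -EFinM; congr (_%:E); lra.
  apply: ge0_le_integral => //.
  - by apply: emeasurable_funM => //; apply/measurable_EFinP; exact: measurable_indic.
  - exact: emeasurable_funM.
  move=> -[x y] _; rewrite /h/= muleC; have [Axy|Axy] := pselect (A (x, y)); last first.
    by rewrite indicE memNset// !mul0e.
  apply: lee_wpmul2l => //; rewrite lee_fin.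
  have /andP[? ?] := AE (x +i* y)%C Axy.
  by rewrite lef_pV2// posrE; lra.
have hupp : haar_int (fun z => h (z ^- k)%R) <= 20%:R%:E.
  have -> : 20%:R%:E = \int[plane]_p (5%:R%:E * (\1_B p)%:E) :> \bar R.
    rewrite integral_plane_scaled_indic// plane_measure_itvX; [|lra|lra].
    by rewrite -EFinM; congr (_%:E); lra.
  have mhk : emeasurable_cfun (fun z => h (z ^- k)%R).
    by apply: (emeasurable_cfun_comp mh); apply: cmeasurableV; exact: cmeasurableX.
  apply: ge0_le_integral => //.
  - by move=> p _; rewrite mule_ge0// haar_density_ge0.
  - exact: emeasurable_funM.
  - by apply: emeasurable_funM => //; apply/measurable_EFinP; exact: measurable_indic.
  move=> -[x y] _ /=; set z := (x +i* y)%C.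
  have [Az|Az] := pselect (A (complex.Re (z ^- k)%R, complex.Im (z ^- k)%R)); last first.
    by rewrite /h indicE memNset// mul0e mule_ge0// lee_fin.
  have := AE _ Az; rewrite ComplexField.Normc.normcV.
  rewrite normcX.
  have := normc_ge0 z; set n := Normc.normc z => n0; rewrite exprVn -exprM mulnC exprM.
  (* At [z = 0] the convention [0^-1 = 0] sends [z ^- k] to 0, which is not in [A]. *)
  have [n00|n00] := eqVneq n 0%R.
    by rewrite n00 expr0n/= expr0n gtn_eqF//= invr0 ltNge ler01.
  have np : (0 < n)%R by rewrite lt0r n00.
  have n2 : (0 < n ^+ 2)%R by rewrite exprn_gt0.
  (* From [1/5 <= n^(2k) < 1] follows [1/5 <= n^2 < 1]: the point lies in [B], of area 4, and the
     density there is at most 5. *)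
  rewrite invf_gt1 ?exprn_gt0// => /andP[nk1].
  rewrite -[X in (_ <= X)%R]invrK lef_pV2 ?posrE ?exprn_gt0 ?invr_gt0// => nk5.
  have n21 : (n ^+ 2 < 1)%R by rewrite ltNge; apply/negP => /(exprn_ege1 k); rewrite leNgt nk1.
  have n2k : ((n ^+ 2) ^+ k <= n ^+ 2)%R.
    by rewrite -[X in (_ <= X)%R]expr1; apply: ler_wiXn2l => //; exact: ltW.
  have := normcX2E z; rewrite -/n /= => nE.
  have Bxy : B (x, y) by rewrite /B/= !in_itv/=; split; apply/andP; split; nra.
  rewrite [X in _ <= _ * X](_ : _ = 1); last by rewrite indicE mem_set.
  rewrite mule1 /h indicE mem_set// mul1e lee_fin -/n.
  rewrite -[X in (_ <= X)%R]invrK lef_pV2 ?posrE//.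
  exact: le_trans nk5 n2k.
have HG : haar_int (fun z => G (z ^+ k)%R) * haar_int h <= 20%:R%:E * haar_int G.
  rewrite haar_int_pow//; apply: lee_wpmul2r => //.
  by apply: integral_ge0 => p _; rewrite mule_ge0// haar_density_ge0.
have Hk0 : 0 <= haar_int (fun z => G (z ^+ k)%R).
  by apply: integral_ge0 => p _; rewrite mule_ge0// haar_density_ge0.
have := le_trans (lee_wpmul2l Hk0 hlow) HG.
rewrite muleC => /(lee_wpmul2l (_ : 0 <= 5%:R%:E)).
rewrite !muleA -!EFinM mulfV// mul1e -natrM; exact.
Qed.
End haar_bound.

(** * Complex differentiability on the disk and the formula for [T_k s_m] *)

Lemma derivable1_comp (K : numFieldType) (f g : K^o -> K^o) (z : K^o) :
  derivable g z 1 -> derivable f (g z) 1 -> derivable (f \o g) z 1.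
Proof.
move=> /derivable1_diffP dg /derivable1_diffP df.
by apply/derivable1_diffP; exact: differentiable_comp.
Qed.

Section analytic.
Variable R : realType.
Local Notation C := R[i].
Implicit Types f g : C -> C.

Lemma nbhs_disk (z : C) : disk z -> nbhs (z : C^o) (@disk R : set C^o).
Proof.
rewrite disk_lt1 => z1; apply/(@nbhs_normP _ C^o z (@disk R)); exists (1 - `|z|).
  by rewrite /= subr_gt0.
move=> y /=; rewrite disk_lt1 => zy.
rewrite -[y](subKr z) (le_lt_trans (ler_normB _ _))//.
by rewrite addrC -ltrBrDr.
Qed.

Lemma eq_analytic f g : (forall z, disk z -> f z = g z) ->
  analytic_on_disk f -> analytic_on_disk g.
Proof.
move=> fg af z zD; apply: (@near_eq_derivable _ _ _ (f : C^o -> C^o)) (af z zD).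
by move: (nbhs_disk zD); apply: filterS => y /fg.
Qed.

Lemma analytic_cst (c : C) : analytic_on_disk (fun _ => c).
Proof. by move=> z _; exact: derivable_cst. Qed.

Lemma analytic_id : analytic_on_disk (fun z : C => z).
Proof. by move=> z _; exact: derivable_id. Qed.

Lemma analyticM f g : analytic_on_disk f -> analytic_on_disk g ->
  analytic_on_disk (fun z => f z * g z).
Proof.
by move=> af ag z zD; exact: (derivableM (f := f : C^o -> C^o) (g := g) (af z zD) (ag z zD)).
Qed.

Lemma analyticB f g : analytic_on_disk f -> analytic_on_disk g ->
  analytic_on_disk (fun z => f z - g z).
Proof.
by move=> af ag z zD; exact: (derivableB (f := f : C^o -> C^o) (g := g) (af z zD) (ag z zD)).
Qed.

Lemma analyticX f n : analytic_on_disk f -> analytic_on_disk (fun z => f z ^+ n).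
Proof.
move=> af; elim: n => [|n IH].
  by under eq_fun do rewrite expr0; exact: analytic_cst.
by under eq_fun do rewrite exprS; exact: analyticM.
Qed.

Lemma analyticV f : (forall z, disk z -> f z != 0) -> analytic_on_disk f ->
  analytic_on_disk (fun z => (f z)^-1).
Proof.
by move=> f0 af z zD; exact: (derivableV (f := f : C^o -> C^o) (f0 z zD) (af z zD)).
Qed.

Lemma analytic_sum n (h : 'I_n -> C -> C) : (forall i, analytic_on_disk (h i)) ->
  analytic_on_disk (fun z => \sum_(i < n) h i z).
Proof.
move=> ah z zD; rewrite (_ : (fun z => _) = \sum_(i < n) (h i : C^o -> C^o)).
  by apply: derivable_sum => i; exact: ah.
by apply/funext => y; rewrite fct_sumE.
Qed.

Lemma analytic_compX f k : (0 < k)%N -> analytic_on_disk f ->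
  analytic_on_disk (fun z => f (z ^+ k)).
Proof.
move=> k0 af z zD.
apply: (@derivable1_comp _ (f : C^o -> C^o) (fun y : C^o => y ^+ k)); last exact/af/diskX.
have aX := @analyticX (fun y => y) k analytic_id z zD.
exact: aX.
Qed.

(** Read off the closed form, whose denominators do not vanish on the disk. *)
Lemma analytic_s_fun k : (0 < k)%N -> analytic_on_disk (@s_fun R k).
Proof.
move=> k0; apply: (@eq_analytic (s_closed k)) => [z zD|].
  by rewrite s_fun_closed.
have a1 : analytic_on_disk (fun z : C => 1 - z).
  by apply: analyticB; [exact: analytic_cst|exact: analytic_id].
have ak : analytic_on_disk (fun z : C => 1 - z ^+ k).
  by apply: analyticB; [exact: analytic_cst|exact: analyticX (@analytic_id)].
apply: analyticB; apply: analyticM.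
- exact: analytic_cst.
- apply: analyticV; last exact: analyticX.
  by move=> z zD; rewrite expf_neq0// one_sub_neq0.
- exact: analyticX (@analytic_id).
apply: analyticV; last exact: analyticM.
by move=> z zD; rewrite mulf_neq0// one_sub_neq0//; exact: diskX.
Qed.

Lemma analytic_T_op k f : (0 < k)%N -> analytic_on_disk f -> analytic_on_disk (T_op k f).
Proof.
move=> k0 af; apply: analyticM; apply: analyticM.
- by apply: analyticM; [exact: analytic_cst|exact: analyticX (@analytic_id)].
- exact: analytic_compX.
- by apply: analyticB; [exact: analytic_cst|exact: analyticX (@analytic_id)].
apply: analyticV; first by move=> z zD; rewrite one_sub_neq0.
by apply: analyticB; [exact: analytic_cst|exact: analytic_id].
Qed.

Lemma T_op_s_fun (k m : nat) (z : C) : (0 < k)%N -> (0 < m)%N -> disk z ->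
  T_op k (s_fun m) z = (Num.sqrt (k%:R : R))%:C * (s_fun (k * m) z - m%:R^-1 * s_fun k z).
Proof.
move=> k0 m0 zD; have zkD := diskX k0 zD.
have km0 : (0 < k * m)%N by rewrite muln_gt0 k0.
rewrite /T_op !s_fun_closed// /s_closed natrM -!exprM.
(* The exponents agree because [km - 1 = (k - 1) + k (m - 1)]. *)
have -> : z ^+ (k * m).-1 = z ^+ k.-1 * z ^+ (k * m.-1).
  rewrite -exprD; congr (_ ^+ _); case: m m0 {km0} => // m _; case: k k0 {zkD} => // k _.
  by rewrite mulnS addSn.
have zk1 := one_sub_neq0 zD; have zk2 := one_sub_neq0 zkD.
have := one_sub_neq0 (diskX km0 zD).
have kn : k%:R != 0 :> C by rewrite pnatr_eq0 -lt0n.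
have mn : m%:R != 0 :> C by rewrite pnatr_eq0 -lt0n.
(* Once the powers are named, the claim is a rational identity in independent variables. *)
move: zk2; set a := z ^+ k; set b := z ^+ (k * m); set c := z ^+ k.-1.
set d := z ^+ (_ * _.-1) => a1 b1.
by field; rewrite mn kn zk1 a1 b1.
Qed.
End analytic.

(** * Measurability of analytic functions on the disk *)

Section disk_measurability.
Variable R : realType.
Local Notation C := R[i].
Local Notation T := (measurableTypeR R).

(** An open set is the union of the rational boxes it contains, and these are countably many. *)
Lemma measurable_box_open (U : set (T * T)) :
  (forall p, U p -> exists2 e : R, 0 < e &
     forall q, `|q.1 - p.1| < e -> `|q.2 - p.2| < e -> U q) ->
  measurable U.
Proof.
move=> Uopen.
pose box (a b c d : rat) : set (T * T) :=
  `]ratr a, ratr b[%classic `*` `]ratr c, ratr d[%classic.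
have mbox a b c d : measurable (box a b c d).
  by apply: measurableX; exact: measurable_itv.
(* The condition that the box lies in [U] sits inside the set, so the unions run over all rationals
   and each member is a box or empty. *)
rewrite (_ : U = \bigcup_a \bigcup_b \bigcup_c \bigcup_d
    [set p | box a b c d p /\ box a b c d `<=` U]); last first.
  apply/seteqP; split => [[x y] /Uopen[e e0 He]|p [a _ [b _ [c _ [d _ [pb]]]]]]; last exact.
  have below (t : R) : t - e < t by rewrite ltrBlDr ltrDl.
  have above (t : R) : t < t + e by rewrite ltrDl.
  have [a] := rat_in_itvoo (below x); have [b] := rat_in_itvoo (above x).
  have [c] := rat_in_itvoo (below y); have [d] := rat_in_itvoo (above y).
  rewrite !in_itv/= => /andP[d1 d2] /andP[c1 c2] /andP[b1 b2] /andP[a1 a2].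
  exists a => //; exists b => //; exists c => //; exists d => //; split.
    by split; rewrite /= in_itv/=; apply/andP.
  move=> -[x' y'] [/=]; rewrite !in_itv/= => /andP[? ?] /andP[? ?].
  by apply: He => /=; rewrite ltr_norml; apply/andP; split; lra.
do 4 (apply: bigcupT_measurable_rat => ?).
set B := box _ _ _ _; have mB : measurable B by exact: mbox.
have [BU|BU] := pselect (B `<=` U).
  rewrite [X in measurable X](_ : _ = B)//.
  by apply/seteqP; split => [p []//|p Bp]; split.
rewrite [X in measurable X](_ : _ = set0); first exact: measurable0.
by apply/seteqP; split => // p [].
Qed.

(** Extension by 0 discards the arbitrary values of [f] off the disk and lets integrals run over the
    whole plane. *)
Definition disk_normsq (f : C -> C) (z : C) : R :=
  if Normc.normc z < 1 then Normc.normc (f z) ^+ 2 else 0.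

(** Superlevel sets suffice: at a negative level they are the whole plane, otherwise they are open
    subsets of the disk by continuity of [f]. *)
Lemma measurable_disk_normsq (f : C -> C) : analytic_on_disk f ->
  measurable_fun setT (fun p : T * T => disk_normsq f (p.1 +i* p.2)).
Proof.
move=> af mD; apply: (measurability _ (RGenOInfty.measurableE R)) => // {mD}.
move=> _ [_ [a ->] <-]; rewrite setTI.
have [a0|a0] := ltrP a 0.
  rewrite (_ : _ @^-1` _ = setT)//; apply/seteqP; split => // p _ /=.
  rewrite in_itv/= andbT (lt_le_trans a0)// /disk_normsq; case: ifP => // _.
  exact: sqr_ge0.
apply: measurable_box_open => -[x y] /=; rewrite in_itv/= andbT /disk_normsq.
case: ifPn => [z1|_]; last by rewrite ltNge a0.
set z := x +i* y => afz.
have cf : {for z, continuous (f : C^o -> C^o)}.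
  by have /derivable1_diffP/differentiable_continuous := af z z1.
have sqrtafz : Num.sqrt a < Normc.normc (f z).
  by rewrite -(ger0_norm (normc_ge0 (f z))) -sqrtr_sqr ltr_sqrt// (le_lt_trans a0).
have d0 : (0 : C) < (Normc.normc (f z) - Num.sqrt a)%:C.
  by rewrite ltcE/= eqxx subr_gt0.
have : \forall w \near (z : C^o), disk w /\ a < Normc.normc (f w) ^+ 2.
  near=> w; split; first by near: w; exact: nbhs_disk.
  have : `|f z - f w| < (Normc.normc (f z) - Num.sqrt a)%:C.
    near: w; apply: (@cvgr_dist_lt C C^o _ _ _ f (f z) cf).
      exact: (@nbhs_filter C^o z).
    exact: d0.
  rewrite normc_normE ltcR => fzw.
  have : Normc.normc (f z) <= Normc.normc (f z - f w) + Normc.normc (f w).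
    by rewrite -{1}[f z](subrK (f w)) le_normcD.
  move=> ?; rewrite -(sqr_sqrtr a0) ltr_pXn2r// ?nnegrE ?sqrtr_ge0 ?normc_ge0//.
  by lra.
move=> /(@nbhs_normP _ C^o z _)[e /= e0 He].
have eE : e = (complex.Re e)%:C by rewrite RRe_real// gtr0_real.
(* Half the radius, since the modulus is at most the sum of the two coordinate differences. *)
exists (complex.Re e / 2); first by rewrite divr_gt0// -ltcR -eE.
move=> -[x' y'] /= xx' yy'; have [] := He (x' +i* y').
  rewrite /= eE normc_normE ltcR (le_lt_trans (normcB_le _ _ _ _))//.
  by rewrite (distrC x) (distrC y); lra.
by rewrite /disk/= in_itv/= andbT => -> .
Unshelve. all: by end_near.
Qed.
End disk_measurability.

(** * Boundedness of [T_k] and invariance of [H_0] *)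

Section bergman.
Variable R : realType.
Local Notation C := R[i].
Local Notation T := (measurableTypeR R).
Local Notation plane := (plane_measure (R := R)).
Implicit Types f g : C -> C.

Definition dA1_weight (z : C) : R := 2 * (1 - Normc.normc z ^+ 2) / pi.

Lemma integral_dA1E f : integral_dA1 (fun z => Normc.normc (f z) ^+ 2) =
  (\int[plane]_p (disk_normsq f (p.1 +i* p.2)%C * dA1_weight (p.1 +i* p.2)%C)%R%:E)%E.
Proof.
rewrite /integral_dA1 integral_mkcond; apply: eq_integral => p _.
rewrite patchE /disk_normsq; case: ifPn => [/set_mem|/negP pD]; rewrite /disk/=.
  by move=> ->.
by case: ifPn => // pD'; [exfalso; apply: pD; exact/mem_set|rewrite mul0r].
Qed.

Lemma dA1_weight_ge0 (z : C) : Normc.normc z < 1 -> 0 <= dA1_weight z.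
Proof.
move=> z1; rewrite divr_ge0// ?pi_ge0// mulr_ge0// subr_ge0.
by rewrite expr_le1// ?normc_ge0// ltW.
Qed.

Lemma disk_normsq_weight_ge0 f (z : C) : 0 <= disk_normsq f z * dA1_weight z.
Proof.
rewrite /disk_normsq; case: ifPn => [z1|_]; last by rewrite mul0r.
by rewrite mulr_ge0// ?sqr_ge0// dA1_weight_ge0.
Qed.

Lemma measurable_dA1_weight : measurable_fun setT (fun p : T * T => dA1_weight (p.1 +i* p.2)).
Proof.
apply: measurable_funM => //; apply: measurable_funM => //.
by apply: measurable_funB => //; exact: (measurable_normcX2 (@cmeasurable_id R)).
Qed.

(** The quotient is a geometric sum of [k] terms of modulus at most 1. *)
Lemma normc_geometric_le (k : nat) (z : C) : disk z ->
  Normc.normc ((1 - z ^+ k) / (1 - z)) <= k%:R.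
Proof.
move=> zD; rewrite -lecR -normc_normE rmorph_nat.
have -> : (1 - z ^+ k) / (1 - z) = \sum_(i < k) z ^+ i.
  have -> : 1 - z ^+ k = (1 - z) * \sum_(i < k) z ^+ i.
    by rewrite -opprB subrX1; ring.
  by rewrite mulrAC mulfV ?mul1r// one_sub_neq0.
rewrite (le_trans (ler_norm_sum _ _ _))// -[X in _ <= X%:R]card_ord -sumr_const.
by apply: ler_sum => i _; rewrite normrX exprn_ile1// ltW// -disk_lt1.
Qed.

(* At z = 0 the right-hand side is the junk value 0; [1 < k] makes the left-hand
   side vanish there too. *)
Lemma T_op_pointwise_le (k : nat) f (z : C) : (1 < k)%N -> disk z ->
  Normc.normc (T_op k f z) ^+ 2 * dA1_weight z <=
  k%:R ^+ 3 * (Normc.normc (f (z ^+ k)) ^+ 2 * dA1_weight (z ^+ k) * Normc.normc (z ^+ k) ^+ 2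
    * (Normc.normc z ^+ 2)^-1).
Proof.
move=> k1 zD; have k0 := ltnW k1.
have q := normc_geometric_le k zD.
have kp : (k.-1 == 0%N) = false by case: (k) k1 => [|[]].
rewrite /T_op; move: ((1 - z ^+ k) / (1 - z)) q => w q.
rewrite !ComplexField.Normc.normcM !normcX.
have -> : Normc.normc (Num.sqrt (k%:R : R))%:C = Num.sqrt k%:R.
  by rewrite /= expr0n addr0 sqrtr_sqr ger0_norm ?sqrtr_ge0.
set Q := Normc.normc w in q *.
rewrite !exprMn sqr_sqrtr ?ler0n//; set n := Normc.normc z.
have n0 : 0 <= n := normc_ge0 z; have n1 : n < 1 := zD.
have [nz|nz] := eqVneq n 0.
  rewrite nz; have -> : (0 : R) ^+ k.-1 = 0 by rewrite expr0n kp.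
  by rewrite expr0n/= invr0 !(mul0r, mulr0).
have kE : (n ^+ k) ^+ 2 / n ^+ 2 = (n ^+ k.-1) ^+ 2.
  by rewrite -{1}(prednK k0) (exprS n k.-1) exprMn mulrAC mulfV ?mul1r// expf_neq0.
set N := Normc.normc (f (z ^+ k)); set a := (n ^+ k.-1) ^+ 2 in kE *.
(* After removal of the common factor, what remains is [Q <= k] and the monotonicity of the weight,
   which decreases with the modulus while [|z^k| <= |z|]. *)
rewrite [leLHS](_ : _ = (k%:R * a * N ^+ 2) * (Q ^+ 2 * dA1_weight z)); last by ring.
rewrite [leRHS](_ : _ = (k%:R * a * N ^+ 2) * (k%:R ^+ 2 * dA1_weight (z ^+ k))); last first.
  by rewrite -kE; ring.
apply: ler_wpM2l.
  by apply: mulr_ge0; last exact: sqr_ge0; apply: mulr_ge0 => //; exact: sqr_ge0.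
apply: ler_pM; rewrite ?sqr_ge0 ?dA1_weight_ge0//.
  by rewrite ler_pXn2r// nnegrE ?normc_ge0.
rewrite /dA1_weight ler_pM2r ?invr_gt0 ?pi_gt0// ler_pM2l// lerD2l lerN2 normcX.
rewrite ler_pXn2r// ?nnegrE ?exprn_ge0//.
by rewrite -[leRHS]expr1 ler_wiXn2l// ltW.
Qed.

(** A bound for the squared norm of [T_k], [k > 1]: the cube comes from [T_op_pointwise_le], the 100
    from [haar_int_pow_le]. *)
Definition T_op_const (k : nat) : R := k%:R ^+ 3 * 100%:R.

Lemma integral_dA1_T_op_le (k : nat) f : (1 < k)%N -> analytic_on_disk f ->
  (integral_dA1 (fun z => (Normc.normc (T_op k f z) ^+ 2)%R) <=
   (T_op_const k)%:E * integral_dA1 (fun z => (Normc.normc (f z) ^+ 2)%R))%E.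
Proof.
move=> k1 af; have k0 := ltnW k1; rewrite !integral_dA1E.
have aT := analytic_T_op k0 af.
have mN (g : C -> C) : analytic_on_disk g -> measurable_fun setT
    (fun p : T * T => disk_normsq g (p.1 +i* p.2) * dA1_weight (p.1 +i* p.2)).
  move=> ag; apply: measurable_funM; last exact: measurable_dA1_weight.
  exact: measurable_disk_normsq.
(* The factor [|z|^2] cancels the Haar density, so that the Haar integral of [G] is at most the
   weighted integral of [|f|^2]. *)
pose G (z : C) : \bar R := (disk_normsq f z * dA1_weight z * Normc.normc z ^+ 2)%:E.
have G0 (z : C) : (0 <= G z)%E by rewrite lee_fin mulr_ge0 ?sqr_ge0// disk_normsq_weight_ge0.
have mG : emeasurable_cfun G.
  apply/measurable_EFinP; apply: measurable_funM; first exact: mN.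
  exact: (measurable_normcX2 (@cmeasurable_id R)).
have mGk : emeasurable_cfun (fun z => G (z ^+ k)).
  by apply: (emeasurable_cfun_comp mG); apply: cmeasurableX; exact: cmeasurable_id.
have K0 : (0 <= (k%:R ^+ 3)%:E :> \bar R)%E by rewrite lee_fin exprn_ge0.
have md := measurable_haar_density (@cmeasurable_id R).
have GkE : ((k%:R ^+ 3)%:E * haar_int (fun z => G (z ^+ k)%R) =
    \int[plane]_p ((k%:R ^+ 3)%:E * (G ((p.1 +i* p.2) ^+ k)%R * haar_density (p.1 +i* p.2)%C)))%E.
  rewrite /haar_int ge0_integralZl_EFin// ?exprn_ge0//.
  - by move=> p _; rewrite mule_ge0// haar_density_ge0.
  - exact: emeasurable_funM.
apply: (@le_trans _ _ ((k%:R ^+ 3)%:E * haar_int (fun z => G (z ^+ k)%R))%E).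
  rewrite GkE; apply: ge0_le_integral => //.
  - by move=> p _; rewrite lee_fin disk_normsq_weight_ge0.
  - by apply/measurable_EFinP; exact: mN.
  - by apply: emeasurable_funM => //; exact: emeasurable_funM.
  move=> p _; set z := p.1 +i* p.2; rewrite -!EFinM lee_fin /disk_normsq.
  case: ifPn => [zD|_]; last first.
    rewrite mul0r mulr_ge0 ?exprn_ge0// mulr_ge0 ?invr_ge0 ?sqr_ge0//.
    by have := G0 (z ^+ k); rewrite lee_fin.
  by have := diskX k0 zD; rewrite /disk/= => ->; exact: T_op_pointwise_le.
rewrite /T_op_const (EFinM (k%:R ^+ 3)) -muleA; apply: lee_wpmul2l => //.
apply: (le_trans (haar_int_pow_le k0 mG G0)). apply: lee_wpmul2l => //.
apply: ge0_le_integral => //.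
- by move=> p _; rewrite mule_ge0// haar_density_ge0.
- exact: emeasurable_funM.
- by apply/measurable_EFinP; exact: mN.
move=> p _; set z := p.1 +i* p.2; rewrite -EFinM lee_fin -(mulrA (_ * dA1_weight z)) ler_piMr//.
  exact: disk_normsq_weight_ge0.
have [->|nz] := eqVneq (Normc.normc z ^+ 2) 0; first by rewrite mul0r.
by rewrite mulfV.
Qed.

Lemma bergman_norm_T_op_le (k : nat) f : (1 < k)%N -> analytic_on_disk f ->
  (bergman_norm (T_op k f) <= (Num.sqrt (T_op_const k))%:E * bergman_norm f)%E.
Proof.
move=> k1 af; rewrite /bergman_norm -[X in (X * _)%E]/(sqrte (T_op_const k)%:E) -sqrteM.
  rewrite lee_sqrt ?integral_dA1_T_op_le// mule_ge0//.
    by rewrite lee_fin mulr_ge0// exprn_ge0.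
  rewrite integral_dA1E; apply: integral_ge0 => p _.
  by rewrite lee_fin disk_normsq_weight_ge0.
by rewrite lee_fin mulr_ge0// exprn_ge0.
Qed.

Lemma eq_bergman_norm f g : (forall z, disk z -> f z = g z) ->
  bergman_norm f = bergman_norm g.
Proof.
move=> fg; rewrite /bergman_norm; congr sqrte; apply: eq_integral => p /set_mem pD.
by rewrite fg.
Qed.

Lemma eq_H0 f g : (forall z, disk z -> f z = g z) -> @H0 R f -> @H0 R g.
Proof.
move=> fg [[af nf] Hf]; split.
  by split; [exact: eq_analytic af|rewrite -(eq_bergman_norm fg)].
move=> e /Hf[h hS he]; exists h => //; rewrite (@eq_bergman_norm _ (fun z => f z - h z))//.
by move=> z zD; rewrite fg.
Qed.

(** By [T_op_s_fun] each generator [s_m] yields a combination of [s_(km)] and [s_k], both generators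
    again; hence [n + n] terms in the witness. *)
Lemma lin_span_T_op (k : nat) g : (1 < k)%N ->
  lin_span [set s_fun (R := R) k | k in [set k : nat | (2 <= k)%N]] g ->
  analytic_on_disk g /\
  exists2 g', lin_span [set s_fun (R := R) k | k in [set k : nat | (2 <= k)%N]] g' &
    forall z, disk z -> T_op k g z = g' z.
Proof.
move=> k1 [n [c [h [hS ->]]]]; have k0 := ltnW k1.
have /choice[m mP] : forall i, exists m, (2 <= m)%N /\ h i = s_fun m.
  by move=> i; have [m m2 <-] := hS i; exists m.
split.
  apply: analytic_sum => i; apply: analyticM; first exact: analytic_cst.
  by have [m2 ->] := mP i; apply: analytic_s_fun; exact: ltnW.
pose q : C := (Num.sqrt (k%:R : R))%:C.
exists (fun z => \sum_(i < n + n)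
  (match fintype.split i with inl i => c i * q | inr i => - (c i * q / (m i)%:R) end) *
  (match fintype.split i with inl i => s_fun (k * m i) | inr i => s_fun k end) z).
  exists (n + n)%N,
    (fun i => match fintype.split i with inl i => c i * q | inr i => - (c i * q / (m i)%:R) end),
    (fun i => match fintype.split i with inl i => s_fun (k * m i) | inr i => s_fun k end).
  split=> // i.
  case: (fintype.split i) => j; [exists (k * m j)%N => //=|by exists k].
  by have [m2 _] := mP j; rewrite -[2%N]muln1 leq_mul// ltnW.
move=> z zD; rewrite big_split_ord/= /T_op big_distrr/= big_distrl/= -big_split/=.
apply: eq_bigr => i _.
rewrite (unsplitK (inl i)) (unsplitK (inr i)).
have [m2 hE] := mP i; have := T_op_s_fun k0 (ltnW m2) zD; rewrite -hE /T_op -/q => HT.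
rewrite [LHS](_ : _ = c i * (q * z ^+ k.-1 * h i (z ^+ k) * ((1 - z ^+ k) / (1 - z)))).
  by rewrite HT; ring.
by ring.
Qed.

(** For [k > 1] the bounded [T_k] carries approximants in the span to approximants in the span; for
    [k = 1] it is the identity on the disk. *)
Lemma T_op_H0 (k : nat) f : (0 < k)%N -> @H0 R f -> @H0 R (T_op k f).
Proof.
case: k => [//|[_|k' _]].
  apply: eq_H0 => z zD; rewrite /T_op sqrtr1 !mul1r !expr1 mulfV ?mulr1//.
  exact: one_sub_neq0.
set k := k'.+2; have k1 : (1 < k)%N by [].
move=> [[af nf] Hf]; have k0 := ltnW k1.
have K0 : 0 < Num.sqrt (T_op_const k) by rewrite sqrtr_gt0 mulr_gt0// exprn_gt0.
split.
  split; first exact: analytic_T_op.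
  rewrite (le_lt_trans (bergman_norm_T_op_le k1 af))// lte_mul_pinfty//.
(* The tolerance is divided by the operator bound in advance. *)
move=> e e0; have [|g gS fg] := Hf (e / Num.sqrt (T_op_const k)).
  by rewrite divr_gt0.
have [ag [g' g'S Tg]] := lin_span_T_op k1 gS; exists g' => //.
rewrite (@eq_bergman_norm _ (T_op k (fun z => f z - g z))); last first.
  by move=> z zD; rewrite -Tg// /T_op; ring.
apply: (le_lt_trans (bergman_norm_T_op_le k1 (analyticB af ag))).
by rewrite muleC -lte_pdivlMr.
Qed.
End bergman.

Unset Implicit Arguments.
Set Strict Implicit.

Theorem lemma1p3 (R : realType) :
  (forall k m : nat, (1 <= k)%N -> (2 <= m)%N ->
     forall z : R[i], disk z ->
       T_op k (s_fun m) z =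
       (Num.sqrt (k%:R : R))%:C * (s_fun (k * m) z - m%:R^-1 * s_fun k z))
  /\
  (forall k : nat, (1 <= k)%N -> [set T_op k f | f in @H0 R] `<=` @H0 R).
Proof.
split=> [k m k1 m2 z zD|k k1 _ [f Hf <-]]; first exact: T_op_s_fun (ltnW m2) zD.
exact: T_op_H0.
Qed.
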